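(* Let $\mathbf p\in\mathcal P$, let $\boldsymbol\delta$ be a random vector in $\mathcal P$ and $S(\mathbf p,\boldsymbol\delta)=\gamma(\boldsymbol\delta-\mathbf p)$ with $\gamma\in\mathbb R$ (the law of $\boldsymbol\delta$ and $\gamma$ not depending on $c$ or $Z$). For $c\in(0,1]$ and $Z:\mathcal P\to\mathbb R$ let $$\psi_{SFE}(\mathbf p)=E\Big[\frac{Z((1-c)\mathbf p+c\boldsymbol\delta)}{c}S(\mathbf p,\boldsymbol\delta)\Big].$$ Suppose that for every $Z:\mathcal P\to\mathbb R$ that is $\mathcal C^2$ and such that $Z$, $\nabla Z$ and $\nabla^2Z$ are Lipschitz on $\mathcal P$ (with some constants $L_0,L_1,L_2$) there is a real number $\epsilon_0(\mathbf p)$ depending on $\mathbf p$ (and possibly on $Z$ and $c$) such that $$\psi_{SFE}(\mathbf p)-\nabla Z(\mathbf p)-\epsilon_0(\mathbf p)\mathbf 1=O(c^2)\quad\text{as }c\to0_+ .$$ Then the following three conditions hold: (MC1) $E[S(\mathbf p,\boldsymbol\delta)]=\mathbf 0$; (MC2) $E[(\boldsymbol\delta-\mathbf p)S(\mathbf p,\boldsymbol\delta)']=\mathbf I-\lambda\mathbf 1\mathbf 1'$ for some $\lambda\in\mathbb R$; (MC3) there is $\mu\in\mathbb R$ such that $E[(\boldsymbol\delta-\mathbf p)_i(\boldsymbol\delta-\mathbf p)_jS(\mathbf p,\boldsymbol\delta)_k]=\mu$ for all $i,j,k\in\{1,\dots,n\}$.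
   Context: $\mathcal P=\{\mathbf p\in\mathbb R^n: \sum_i p_i=1,\ p_i\ge 0\}$ is the probability simplex. $\|\cdot\|$ is the Euclidean norm of vectors and the spectral norm of matrices, $\mathbf 1$ is the all-ones vector, $\mathbf I$ the identity matrix, $\mathbf e_i$ the $i$-th standard basis vector, and $'$ denotes transpose. Derivatives on the simplex. A function $F:\mathcal P\to\mathbb R$ is differentiable at $\mathbf p$ if there is a vector $\nabla F(\mathbf p)$ with $F(\mathbf q)-F(\mathbf p)=\nabla F(\mathbf p)'(\mathbf q-\mathbf p)+o(\|\mathbf q-\mathbf p\|)$ for $\mathbf q\in\mathcal P$; such a vector is unique only up to adding multiples of $\mathbf 1$, and $\nabla F(\mathbf p)=(F_1(\mathbf p),\dots,F_n(\mathbf p))'$ always denotes the version $F_i(\mathbf p)=\lim_{\epsilon\to0_+}\frac{F((1-\epsilon)\mathbf p+\epsilon\mathbf e_i)-F(\mathbf p)}{\epsilon}$. Higher derivatives are defined recursively by $F_{i_1,\dots,i_{k+1}}=(F_{i_1,\dots,i_k})_{i_{k+1}}$, and $\nabla^2F(\mathbf p)=(F_{i,j}(\mathbf p))_{i,j}$. $F$ is $\mathcal C^k$ if its derivatives of order up to $k$ exist in this sense and are continuous on $\mathcal P$. $\psi_{SFE}$ is the expectation of the single-function-evaluation gradient estimator $\frac{\hat Z((1-c)\mathbf p+c\boldsymbol\delta)}{c}S(\mathbf p,\boldsymbol\delta)$ based on an unbiased noisy evaluation $\hat Z$ of $Z$ independent of $\boldsymbol\delta$. The implied constant in $O(c^2)$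 may depend on $Z$, $\mathbf p$, $\gamma$ and the law of $\boldsymbol\delta$. *)

(* Defs.v *)
From mathcomp Require Import all_boot all_order all_algebra.
From mathcomp Require Import all_classical all_reals all_analysis.

Set Implicit Arguments.
Unset Strict Implicit.
Unset Printing Implicit Defensive.

Import Order.TTheory GRing.Theory Num.Theory.
Import numFieldNormedType.Exports.

Local Open Scope classical_set_scope.
Local Open Scope ring_scope.

Definition simplex (R : realType) (n : nat) : set 'cV[R]_n :=
  [set p | (forall i, 0 <= p i 0) /\ \sum_i p i 0 = 1].
Arguments simplex : clear implicits.

Definition ones (R : realType) (n : nat) : 'cV[R]_n := const_mx 1.
Arguments ones : clear implicits.

(* The library norm `|x| on matrices is the max norm, so the Euclidean and
   spectral norms are defined here. The topology on 'cV[R]_n is the same for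
   both norms, so the library's continuity is used as it is. *)
Definition euclid_norm (R : realType) (n : nat) (x : 'cV[R]_n) : R :=
  Num.sqrt (\sum_i x i 0 ^+ 2).

Definition spectral_norm (R : realType) (m n : nat) (A : 'M[R]_(m, n)) : R :=
  sup [set euclid_norm (A *m x) | x in [set x : 'cV[R]_n | euclid_norm x <= 1]].

Section simplex_calculus.
Variables (R : realType) (n : nat).

(* A function on the simplex is given as a total function F : 'cV[R]_n -> R;
   differentiability and derivatives at points of the simplex, and hence C^k
   and Lipschitz continuity, only depend on the values of F on the simplex. *)
Implicit Types (F : 'cV[R]_n -> R) (p : 'cV[R]_n).

Definition simplex_differentiable F p : Prop :=
  exists g : 'cV[R]_n,
    (fun q => F q - F p - (g^T *m (q - p)) 0 0 : R^o)
      =o_ (within (simplex R n) (nbhs p)) (fun q => euclid_norm (q - p) : R^o).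

(* If F is differentiable at p with some gradient g, this limit exists and
   equals g_i - g^T p; lim is only meaningful in that case. *)
Definition simplex_partial F (i : 'I_n) : 'cV[R]_n -> R := fun p =>
  lim ((F ((1 - e) *: p + e *: delta_mx i 0) - F p) / e @[e --> 0^'+]).

Definition simplex_grad F p : 'cV[R]_n := \col_i simplex_partial F i p.

(* The (i, j) entry is F_{i,j} = (F_i)_j. *)
Definition simplex_hess F p : 'M[R]_n :=
  \matrix_(i, j) simplex_partial (simplex_partial F i) j p.

Fixpoint simplex_Ck (k : nat) F : Prop :=
  {within simplex R n, continuous F} /\
  (if k is k'.+1 then
     (forall p, simplex R n p -> simplex_differentiable F p) /\
     (forall i, simplex_Ck k' (simplex_partial F i))
   else True).

Definition simplex_lipschitz (V : zmodType) (nrm : V -> R)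
    (f : 'cV[R]_n -> V) : Prop :=
  exists L : R, forall p q, simplex R n p -> simplex R n q ->
    nrm (f p - f q) <= L * euclid_norm (p - q).

End simplex_calculus.

(* Entrywise expectation of a random matrix. It is real-valued by means of
   fine, which would send an infinite expectation to 0; this does not occur for
   bounded measurable entries, which is the case here when delta is measurable
   with values in the simplex and Z is continuous on the simplex. *)
Definition mx_expectation (R : realType) (d : measure_display)
    (T : measurableType d) (P : probability T R) (m n : nat)
    (X : T -> 'M[R]_(m, n)) : 'M[R]_(m, n) :=
  \matrix_(i, j) fine ('E_P[fun w => X w i j])%E.

Definition score (R : realType) (n : nat) (gamma : R) (p x : 'cV[R]_n) :
  'cV[R]_n := gamma *: (x - p).

Definition psi_SFE (R : realType) (d : measure_display) (T : measurableType d)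
    (P : probability T R) (n : nat) (delta : T -> 'cV[R]_n) (gamma : R)
    (Z : 'cV[R]_n -> R) (p : 'cV[R]_n) (c : R) : 'cV[R]_n :=
  mx_expectation P (fun w =>
    (Z ((1 - c) *: p + c *: delta w) / c) *: score gamma p (delta w)).

(* Main.v *)
(* The expansion is tested on the polynomials 1, q_i - p_i and
   (q_i - p_i) (q_j - p_j), homogeneous of degree m = 0, 1, 2 in q - p. For such
   a Z, psi_SFE is exactly c^(m-1) E[Z(delta) S], so the O(c^2) hypothesis makes
   this expression exact up to a multiple of the all-ones vector. For m = 0 the
   vector E[S] is constant, and it is zero because its entries sum to 0. For
   m = 1, 2, the tensors E[(delta - p) S'] - I and E[(delta - p)^2 S] do not
   depend on their last index; being symmetric, they are constant. *)

Require Import Defs.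
From mathcomp Require Import all_boot all_order all_algebra.
From mathcomp Require Import all_classical all_reals all_analysis.
From mathcomp Require Import measurable_realfun ring lra.

Set Implicit Arguments.
Unset Strict Implicit.
Unset Printing Implicit Defensive.

Import Order.TTheory GRing.Theory Num.Theory.
Import numFieldNormedType.Exports.

Local Open Scope classical_set_scope.
Local Open Scope ring_scope.

(** * Comparison of the Euclidean and spectral norms with sums of absolute entries *)

Section euclid.
Variables (R : realType) (n : nat).
Implicit Types x : 'cV[R]_n.

Lemma euclid_norm_ge0 x : 0 <= euclid_norm x.
Proof. exact: sqrtr_ge0. Qed.

Lemma ler_coord_euclid_norm x i : `|x i 0| <= euclid_norm x.
Proof.
rewrite -sqrtr_sqr ler_wsqrtr// (bigD1 i)//= lerDl.
by apply: sumr_ge0 => j _; exact: sqr_ge0.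
Qed.

Lemma ler_euclid_norm_sum x : euclid_norm x <= \sum_i `|x i 0|.
Proof.
have s0 : 0 <= \sum_i `|x i 0| by exact: sumr_ge0.
rewrite -(ger0_norm s0) -sqrtr_sqr ler_wsqrtr//.
rewrite expr2 mulr_suml ler_sum// => i _; rewrite -real_normK ?num_real// expr2.
by rewrite ler_wpM2l// (bigD1 i)//= lerDl sumr_ge0.
Qed.

Lemma ler_norm_euclid_norm x : `|x| <= euclid_norm x.
Proof.
rewrite [`|x|]mx_normrE; apply: bigmax_le => [|[i j] _] /=.
  exact: euclid_norm_ge0.
by rewrite (ord1 j) ler_coord_euclid_norm.
Qed.

End euclid.

(** Reduces Lipschitz bounds on a Hessian to bounds on its entries: coordinates of a vector in the
    unit ball are at most 1 in absolute value. *)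
Lemma ler_spectral_norm_sum (R : realType) m n (A : 'M[R]_(m, n)) :
  spectral_norm A <= \sum_i \sum_j `|A i j|.
Proof.
apply: ge_sup.
  (* A supremum is bounded through its upper bounds only for a nonempty set; the zero vector
     witnesses this. *)
  exists (euclid_norm (A *m 0)), 0 => //=.
  apply: le_trans (ler_euclid_norm_sum _) _.
  by rewrite big1// => i _; rewrite mxE normr0.
move=> _ [x /= x1 <-]; apply: le_trans (ler_euclid_norm_sum _) _.
apply: ler_sum => i _; rewrite mxE (le_trans (ler_norm_sum _ _ _))//.
apply: ler_sum => j _.
by rewrite normrM ler_piMr// (le_trans (ler_coord_euclid_norm _ _)).
Qed.

(** * Polynomial functions satisfy all regularity assumptions on the simplex *)

Section polynomial_functions.
Variables (R : realType) (n : nat).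
Implicit Types (F G : 'cV[R]_n -> R) (p q : 'cV[R]_n).

(** A class containing the test functions and stable under [simplex_partial], so that regularity of
    every order follows by induction. *)
Inductive polynomial_fun : ('cV[R]_n -> R) -> Prop :=
| polynomial_cst a : polynomial_fun (fun=> a)
| polynomial_coord i : polynomial_fun (fun q => q i 0)
| polynomial_add F G : polynomial_fun F -> polynomial_fun G ->
    polynomial_fun (fun q => F q + G q)
| polynomial_mul F G : polynomial_fun F -> polynomial_fun G ->
    polynomial_fun (fun q => F q * G q).

Lemma polynomial_differentiable F p : polynomial_fun F -> differentiable F p.
Proof.
elim=> {F} [a|i|F G _ dF _ dG|F G _ dF _ dG].
- exact: differentiable_cst.
- exact: differentiable_coord.
- exact: differentiableD.
- exact: differentiableM.
Qed.

(** The point (1 - e) p + e e_i is p + e (e_i - p), and the one-sided limit agrees with the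
    two-sided one when the latter exists. *)
Lemma simplex_partial_derive F i p : differentiable F p ->
  simplex_partial F i p = 'D_(delta_mx i 0 - p) F p.
Proof.
move=> /(@diff_derivable _ _ _ _ _ (delta_mx i 0 - p)) dF.
rewrite /derive cvg_at_rightE//; congr (lim (_ @ 0^'+)).
apply/funext => e /=; rewrite [RHS]mulrC; congr ((F _ - _) / _).
by rewrite scalerBl scale1r scalerBr addrC addrA addrAC.
Qed.

Lemma derive_coord (v p : 'cV[R]_n) j : 'D_v (fun q => q j 0) p = v j 0.
Proof.
have := derive_mx (@derivable_id _ _ p v).
by rewrite derive_id => /matrixP/(_ j 0); rewrite mxE => ->.
Qed.

(** The direction e_i - p moves with the base point, but affinely, so coordinates have affine
    derivatives; sums and products follow by Leibniz. *)
Lemma polynomial_partial F i : polynomial_fun F ->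
  polynomial_fun (simplex_partial F i).
Proof.
move=> pF; have -> : simplex_partial F i = fun p => 'D_(delta_mx i 0 - p) F p.
  apply/funext => p; exact/simplex_partial_derive/polynomial_differentiable.
elim: pF => {F} [a|j|F G pF DF pG DG|F G pF DF pG DG].
- under eq_fun do rewrite derive_cst; exact: polynomial_cst.
- have -> : (fun p => 'D_(delta_mx i 0 - p) (fun q => q j 0) p) =
      fun p => (delta_mx i 0 : 'cV[R]_n) j 0 + (-1) * p j 0.
    apply/funext => p; rewrite mulN1r.
    by rewrite derive_coord !mxE.
  apply: polynomial_add; first exact: polynomial_cst.
  by apply: polynomial_mul; [exact: polynomial_cst|exact: polynomial_coord].
- rewrite (_ : (fun p => _) =
      fun p => 'D_(delta_mx i 0 - p) F p + 'D_(delta_mx i 0 - p) G p).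
    exact: polynomial_add.
  by apply/funext => p; apply: deriveD;
    exact/diff_derivable/polynomial_differentiable.
- rewrite (_ : (fun p => _) =
      fun p => F p * 'D_(delta_mx i 0 - p) G p
        + G p * 'D_(delta_mx i 0 - p) F p).
    by apply: polynomial_add; exact: polynomial_mul.
  by apply/funext => p; apply: deriveM;
    exact/diff_derivable/polynomial_differentiable.
Qed.

Lemma polynomial_simplex_bounded F : polynomial_fun F ->
  exists M, forall q, simplex R n q -> `|F q| <= M.
Proof.
elim=> {F} [a|i|F G _ [M FM] _ [N GN]|F G _ [M FM] _ [N GN]].
- by exists `|a|.
- exists 1 => q [q0 q1]; rewrite ger0_norm// -q1 (bigD1 i)//= lerDl.
  exact: sumr_ge0.
- exists (M + N) => q sq; rewrite (le_trans (ler_normD _ _))// lerD//.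
    exact: FM.
  exact: GN.
- exists (M * N) => q sq; rewrite normrM ler_pM//; first exact: FM.
  exact: GN.
Qed.

Lemma polynomial_simplex_lipschitz F : polynomial_fun F ->
  simplex_lipschitz (fun x : R => `|x|) F.
Proof.
elim=> {F} [a|i|F G _ [M FM] _ [N GN]|F G pF [M FM] pG [N GN]].
- by exists 0 => p q _ _; rewrite subrr normr0 mul0r.
- exists 1 => p q _ _; rewrite mul1r.
  by have := ler_coord_euclid_norm (p - q) i; rewrite !mxE.
- exists (M + N) => p q sp sq; rewrite opprD addrACA mulrDl.
  by rewrite (le_trans (ler_normD _ _))// lerD ?FM ?GN.
- have [A FA] := polynomial_simplex_bounded pF.
  have [B GB] := polynomial_simplex_bounded pG.
  exists (A * N + M * B) => p q sp sq.
  rewrite (_ : _ - _ = F p * (G p - G q) + (F p - F q) * G q); last by ring.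
  rewrite (le_trans (ler_normD _ _))// [leRHS]mulrDl !normrM lerD//.
    by rewrite -mulrA ler_pM ?FA ?GN.
  by rewrite mulrAC ler_pM ?GB ?FM.
Qed.

Lemma simplex_lipschitz_sum (I : finType) (V : zmodType) (nrm : V -> R)
    (f : 'cV[R]_n -> V) (F : I -> 'cV[R]_n -> R) :
  (forall p q, nrm (f p - f q) <= \sum_i `|F i p - F i q|) ->
  (forall i, simplex_lipschitz (fun x : R => `|x|) (F i)) ->
  simplex_lipschitz nrm f.
Proof.
move=> fF /choice[L FL]; exists (\sum_i L i) => p q sp sq.
rewrite mulr_suml (le_trans (fF _ _))// ler_sum// => i _; exact: FL.
Qed.

(** The differential on basis vectors serves as gradient; the remainder is small against the max
    norm, hence against the larger Euclidean norm. *)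
Lemma differentiable_simplex_differentiable F p :
  differentiable F p -> simplex_differentiable F p.
Proof.
move=> dF; exists (\col_i 'd F p (delta_mx i 0)).
have dE (v : 'cV[R]_n) : ((\col_i 'd F p (delta_mx i 0))^T *m v) 0 0 = 'd F p v.
  rewrite mxE {2}(matrix_sum_delta v) linear_sum; apply: eq_bigr => i _.
  by rewrite big_ord1 linearZ !mxE mulrC.
apply/eqoP => e e0.
have /eqaddoP/(_ e e0) dF0 := diff_locally dF.
have dFp : \forall q \near p, `|F q - F p - 'd F p (q - p)| <= e * `|q - p|.
  rewrite (near_shift (0 : 'cV[R]_n) p) subr0; apply: filterS dF0 => h /=.
  by rewrite !fctE/= addrK opprD addrA.
apply: (filterS _ dFp) => q dq _; rewrite dE; apply: le_trans dq _.
rewrite ler_wpM2l ?(ltW e0)// [leRHS]ger0_norm ?euclid_norm_ge0//.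
exact: ler_norm_euclid_norm.
Qed.

Lemma polynomial_simplex_Ck k F : polynomial_fun F -> simplex_Ck k F.
Proof.
elim: k F => [|k IH] F pF; (split; first by apply: continuous_subspaceT => p;
  exact/differentiable_continuous/polynomial_differentiable) => //.
split=> [p _|i]; last exact/IH/polynomial_partial.
exact/differentiable_simplex_differentiable/polynomial_differentiable.
Qed.

Lemma polynomial_grad_lipschitz F : polynomial_fun F ->
  simplex_lipschitz (@euclid_norm R n) (simplex_grad F).
Proof.
move=> pF; apply: simplex_lipschitz_sum
  (fun i => simplex_partial F i) _ _ => [p q|i].
  rewrite (le_trans (ler_euclid_norm_sum _))//.
  by apply: ler_sum => i _; rewrite !mxE.
exact/polynomial_simplex_lipschitz/polynomial_partial.
Qed.

Lemma polynomial_hess_lipschitz F : polynomial_fun F ->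
  simplex_lipschitz (@spectral_norm R n n) (simplex_hess F).
Proof.
move=> pF; apply: simplex_lipschitz_sum
  (fun ij => simplex_partial (simplex_partial F ij.1) ij.2) _ _ => [p q|ij].
  rewrite (le_trans (ler_spectral_norm_sum _))// pair_bigA ler_sum//= => i _.
  by rewrite !mxE.
exact/polynomial_simplex_lipschitz/polynomial_partial/polynomial_partial.
Qed.

End polynomial_functions.

Lemma near0_norm_le_eq0 (R : realType) (x K : R) :
  (\forall c \near 0^'+, `|x| <= K * c) -> x = 0.
Proof.
move=> xK; apply/eqP; rewrite -normr_eq0; apply/negPn/negP => x0.
have {}x0 : 0 < `|x| by rewrite lt_def x0 normr_ge0.
(* [K] has no sign, so this positive majorant replaces it; a positive [c] below |x| / (|K| + 1) then
   contradicts the bound. *)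
have K0 : 0 < `|K| + 1 by rewrite ltr_wpDl.
have xK0 : 0 < `|x| / (`|K| + 1) by rewrite divr_gt0.
near (0 : R)^'+ => c.
have c0 : 0 < c by near: c; exact: nbhs_right_gt.
have : c < `|x| / (`|K| + 1) by near: c; exact: nbhs_right_lt.
rewrite ltr_pdivlMr// mulrC ltNge => /negP; apply.
apply: le_trans (_ : K * c <= _); first by near: c.
by rewrite ler_wpM2r ?(ltW c0)// (le_trans (ler_norm _))// lerDl.
Unshelve. all: by end_near.
Qed.

(** * Moments of the score against polynomials *)

Section score_moments.
Variables (R : realType) (n : nat) (d : measure_display).
Variables (T : measurableType d) (P : probability T R).
Variables (p : 'cV[R]_n) (delta : T -> 'cV[R]_n) (gamma : R).
Hypothesis delta_meas : forall i, measurable_fun setT (fun w => delta w i 0).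
Hypothesis delta_simplex : forall w, simplex R n (delta w).
Implicit Types F Z : 'cV[R]_n -> R.

Lemma polynomial_integrable F : polynomial_fun F ->
  P.-integrable setT (EFin \o (F \o delta)).
Proof.
move=> pF; apply: measurable_bounded_integrable => //.
- exact: fin_num_fun_lty.
- elim: pF => {F} [a|i|F G _ mF _ mG|F G _ mF _ mG].
  + exact: measurable_cst.
  + exact: delta_meas.
  + exact: measurable_funD.
  + exact: measurable_funM.
- have [M FM] := polynomial_simplex_bounded pF.
  exists M; split; first exact: num_real.
  by move=> x Mx w _; apply: le_trans (FM _ (delta_simplex w)) _; exact: ltW.
Qed.

Lemma polynomial_Lfun F : polynomial_fun F -> (F \o delta) \in Lfun P 1.
Proof. by move=> pF; apply/Lfun1_integrable/polynomial_integrable. Qed.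

Lemma polynomial_shift i : polynomial_fun (fun q : 'cV[R]_n => (q - p) i 0).
Proof.
rewrite (_ : (fun q => _) = fun q : 'cV[R]_n => q i 0 + (- p i 0)).
  by apply: polynomial_add; [exact: polynomial_coord|exact: polynomial_cst].
by apply/funext => q; rewrite !mxE.
Qed.

Lemma polynomial_score i : polynomial_fun (fun q => score gamma p q i 0).
Proof.
rewrite (_ : (fun q => _) = fun q : 'cV[R]_n => gamma * (q - p) i 0).
  by apply: polynomial_mul; [exact: polynomial_cst|exact: polynomial_shift].
by apply/funext => q; rewrite !mxE.
Qed.

(** For homogeneous [Z], coordinate [k] of [psi_SFE] is this number times a power of [c]. *)
Definition score_moment Z (k : 'I_n) : R :=
  fine 'E_P[fun w => (Z (delta w) * score gamma p (delta w) k 0)%R]%E.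

Lemma score_momentE Z k : polynomial_fun Z ->
  'E_P[fun w => (Z (delta w) * score gamma p (delta w) k 0)%R]%E
    = (score_moment Z k)%:E.
Proof.
move=> pZ; rewrite fineK//; apply: expectation_fin_num.
exact: (polynomial_Lfun (polynomial_mul pZ (polynomial_score k))).
Qed.

(** The coordinates of [delta w] and of [p] both sum to 1, so those of the score sum to 0
    pointwise. *)
Lemma sum_score_moment Z : simplex R n p -> polynomial_fun Z ->
  \sum_k score_moment Z k = 0.
Proof.
move=> [_ p1] pZ; apply: EFin_inj; rewrite -sumEFin.
under eq_bigr do rewrite -(score_momentE _ pZ) unlock.
rewrite -integral_sum//; last first.
  move=> k.
  exact: (polynomial_integrable (polynomial_mul pZ (polynomial_score k))).
apply: integral0_eq => w _; rewrite sumEFin -mulr_sumr.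
under eq_bigr do rewrite !mxE.
have [_ d1] := delta_simplex w.
by rewrite -mulr_sumr sumrB d1 p1 subrr !mulr0.
Qed.

(* [Z] is homogeneous of degree [m] in [q - p]; the condition on [g] says that
   [g] is the difference of the two partial derivatives of [Z] at [p] when
   [m = 1], and that both this difference and [g] vanish otherwise. Comparing
   the coordinates [k] and [l] of [psi_SFE] eliminates [eps0]. *)
Lemma score_moment_diff m Z k l g :
  polynomial_fun Z -> (m <= 2)%N ->
  (forall c q, Z ((1 - c) *: p + c *: q) = c ^+ m * Z q) ->
  (forall c, c * (simplex_grad Z p k 0 - simplex_grad Z p l 0) = c ^+ m * g) ->
  (exists eps0 : R -> R,
    (fun c : R => euclid_norm (psi_SFE P delta gamma Z p c
       - simplex_grad Z p - eps0 c *: ones R n) : R^o)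
     =O_ (0^'+) (fun c : R => c ^+ 2 : R^o)) ->
  score_moment Z k - score_moment Z l = g.
Proof.
move=> pZ m2 hom gradE [eps0 /eqO_exP[K K0 psiO]].
have psiE c j : psi_SFE P delta gamma Z p c j 0 = c ^+ m / c * score_moment Z j.
  rewrite mxE; under eq_fun do rewrite mxE hom.
  have := expectationZl (c ^+ m / c)
    (polynomial_Lfun (polynomial_mul pZ (polynomial_score j))).
  rewrite score_momentE// => E; rewrite -[RHS]/(fine (_ * _)%:E) EFinM -E.
  by congr (fine (expectation _ _)); apply/funext => w /=; ring.
have {}psiO : \forall c \near 0^'+, euclid_norm (psi_SFE P delta gamma Z p c
    - simplex_grad Z p - eps0 c *: ones R n) <= K * c ^+ 2.
  apply: filterS psiO => c; rewrite [X in X <= _]ger0_norm ?euclid_norm_ge0//.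
  by rewrite [X in _ * X]ger0_norm ?sqr_ge0.
apply/subr0_eq/(@near0_norm_le_eq0 _ _ (2 * K)).
near=> c.
have c0 : 0 < c by near: c; exact: nbhs_right_gt.
have c1 : c <= 1 by near: c; exact: nbhs_right_ltW.
pose v := psi_SFE P delta gamma Z p c - simplex_grad Z p - eps0 c *: ones R n.
have vK : euclid_norm v <= K * c ^+ 2 by rewrite /v; near: c.
set x := score_moment Z k - score_moment Z l - g.
(* [eps0 c] cancels in the difference, and [gradE] turns the gradient terms into c^m g. *)
have xE : c ^+ m * x = c * (v k 0 - v l 0).
  have vE j : v j 0 =
      c ^+ m / c * score_moment Z j - simplex_grad Z p j 0 - eps0 c.
    by rewrite -psiE !mxE mulr1.
  by rewrite !vE mulrBr -gradE; field; rewrite gt_eqF.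
have vkl : `|v k 0 - v l 0| <= 2 * (K * c ^+ 2).
  rewrite (le_trans (ler_normB _ _))// mulr_natl mulr2n.
  by rewrite lerD// (le_trans (ler_coord_euclid_norm _ _)).
rewrite -(ler_pM2l (exprn_gt0 m c0)) -[X in X * _ <= _]gtr0_norm ?exprn_gt0//.
rewrite -normrM xE normrM gtr0_norm//.
apply: le_trans (_ : c * (2 * (K * c ^+ 2)) <= _).
  by rewrite ler_wpM2l// ltW.
rewrite (_ : c * _ = 2 * K * c * c ^+ 2); last by ring.
rewrite [leRHS]mulrC ler_wpM2l//; first by rewrite !mulr_ge0// ltW.
(* Here c^2 is at most c^m, as [m] is at most 2 and [c] lies in (0, 1]. *)
by rewrite ler_wiXn2l// ltW.
Unshelve. all: by end_near.
Qed.

End score_moments.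

(** * Deduction of the three moment conditions from the test functions *)

Theorem theorem2 (R : realType) (n : nat) (d : measure_display)
    (T : measurableType d) (P : probability T R)
    (p : 'cV[R]_n) (hp : simplex R n p)
    (delta : T -> 'cV[R]_n)
    (hdelta_meas : forall i, measurable_fun setT (fun w => delta w i 0))
    (hdelta : forall w, simplex R n (delta w))
    (gamma : R)
    (hSFE : forall Z : 'cV[R]_n -> R,
      simplex_Ck 2 Z ->
      simplex_lipschitz (fun x : R => `|x|) Z ->
      simplex_lipschitz (@euclid_norm R n) (simplex_grad Z) ->
      simplex_lipschitz (@spectral_norm R n n) (simplex_hess Z) ->
      exists eps0 : R -> R,
        (fun c : R => euclid_norm (psi_SFE P delta gamma Z p c
             - simplex_grad Z p - eps0 c *: ones R n) : R^o)
          =O_ (0^'+) (fun c : R => c ^+ 2 : R^o)) :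
  [/\ mx_expectation P (fun w => score gamma p (delta w)) = 0,
      exists lambda : R,
        mx_expectation P
          (fun w => (delta w - p) *m (score gamma p (delta w))^T)
        = 1%:M - lambda *: (ones R n *m (ones R n)^T)
    & exists mu : R, forall i j k : 'I_n,
        'E_P[fun w => ((delta w - p) i 0 * (delta w - p) j 0
                       * score gamma p (delta w) k 0)%R]%E = mu%:E].
Proof.
have test m Z k l g : polynomial_fun Z -> (m <= 2)%N ->
    (forall c q, Z ((1 - c) *: p + c *: q) = c ^+ m * Z q) ->
    (forall c, c * (simplex_grad Z p k 0 - simplex_grad Z p l 0)
      = c ^+ m * g) ->
    score_moment P p delta gamma Z k - score_moment P p delta gamma Z l = g.
  move=> pZ m2 hom gradE; apply: score_moment_diff hom gradE _ => //.
  apply: hSFE.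
  - exact: polynomial_simplex_Ck.
  - exact: polynomial_simplex_lipschitz.
  - exact: polynomial_grad_lipschitz.
  - exact: polynomial_hess_lipschitz.
have shift_hom j c (q : 'cV[R]_n) :
    ((1 - c) *: p + c *: q - p) j 0 = c * (q - p) j 0.
  by rewrite !mxE; ring.
have derive_shift j v q : 'D_v (fun q : 'cV[R]_n => (q - p) j 0) q = v j 0.
  rewrite (_ : (fun _ => _) = (fun q : 'cV[R]_n => q j 0) + cst (- p j 0)).
    rewrite deriveD ?derive_cst ?addr0 ?derive_coord//.
    exact/diff_derivable/differentiable_coord.
  by apply/funext => x; rewrite !mxE.
have gradE Z j : polynomial_fun Z ->
    simplex_grad Z p j 0 = 'D_(delta_mx j 0 - p) Z p.
  move=> pZ; rewrite mxE simplex_partial_derive//.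
  exact: polynomial_differentiable.
split.
- apply/matrixP => k z; rewrite (ord1 z) !mxE.
  have pZ : polynomial_fun (fun _ : 'cV[R]_n => 1 : R) by exact: polynomial_cst.
  have E l : score_moment P p delta gamma (fun=> 1) l
      = score_moment P p delta gamma (fun=> 1) k.
    apply/subr0_eq/(test 0) => // c; first by rewrite expr0 mul1r.
    by rewrite !gradE// !derive_cst subrr !mulr0.
  have := sum_score_moment P gamma hdelta_meas hdelta hp pZ.
  under eq_bigr do rewrite E.
  rewrite sumr_const card_ord => /eqP.
  (* [n] copies of one entry sum to 0, and the index [k] rules out n = 0. *)
  rewrite mulrn_eq0 => /orP[/eqP n0|/eqP <-].
    by have := ltn_ord k; rewrite {2}n0.
  by rewrite /score_moment; under [in RHS]eq_fun do rewrite mul1r.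
- pose A i j := score_moment P p delta gamma (fun q => (q - p) i 0) j.
  (* Symmetry holds because the score is a scalar multiple of delta - p. *)
  have Asym i j : A i j = A j i.
    by congr (fine (expectation _ _)); apply/funext => w; rewrite !mxE; ring.
  have Adiff i k l : A i k - A i l = (i == k)%:R - (i == l)%:R.
    apply: (test 1%N) => // [|c]; first exact: polynomial_shift.
    rewrite !gradE; try exact: polynomial_shift.
    by rewrite !derive_shift !mxE !eqxx !andbT expr1; ring.
  have AE : mx_expectation P
      (fun w => (delta w - p) *m (score gamma p (delta w))^T)
      = \matrix_(i, j) A i j.
    apply/matrixP => i j; rewrite !mxE; congr (fine (expectation _ _)).
    by apply/funext => w; rewrite mxE big_ord1 [_^T _ _]mxE.
  case: (pickP 'I_n) => [z _|no]; last first.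
    by exists 0; apply/matrixP => i; have := no i.
  (* Go from (i, j) to (i, z) by [Adiff], transpose to (z, i), and go to (z, z) by [Adiff] again: A
     i j = [i = j] - 1 + A z z. *)
  exists (1 - A z z); rewrite AE; apply/matrixP => i j.
  rewrite !mxE big_ord1 !mxE mulr1.
  have := Adiff i j z; have := Adiff z i z.
  rewrite (Asym z i) eqxx (eq_sym z i).
  by rewrite mulr1 mulr1n; move: (i == j)%:R (i == z)%:R => a b; lra.
- pose Z i j (q : 'cV[R]_n) := (q - p) i 0 * (q - p) j 0.
  have pZ i j : polynomial_fun (Z i j).
    by apply: polynomial_mul; exact: polynomial_shift.
  pose M i j k := score_moment P p delta gamma (Z i j) k.
  have M12 i j k : M i j k = M j i k.
    by congr (fine (expectation _ _)); apply/funext => w; rewrite /Z !mxE; ring.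
  have M13 i j k : M i j k = M k j i.
    by congr (fine (expectation _ _)); apply/funext => w; rewrite /Z !mxE; ring.
  have M3 i j k l : M i j k = M i j l.
    apply/subr0_eq/(test 2) => // [c q|c]; first by rewrite /Z !shift_hom; ring.
    (* Both factors vanish at [p], so the Leibniz rule gives 0. *)
    have Z0 v : 'D_v (Z i j) p = 0.
      rewrite [LHS](@deriveM _ _ (fun q => (q - p) i 0) (fun q => (q - p) j 0)).
      + by rewrite subrr !mxE !scale0r addr0.
      + exact/diff_derivable/polynomial_differentiable/polynomial_shift.
      + exact/diff_derivable/polynomial_differentiable/polynomial_shift.
    by rewrite !gradE// !Z0 subrr !mulr0.
  case: (pickP 'I_n) => [z _|no]; last by exists 0 => i; have := no i.
  exists (M z z z) => i j k.
  rewrite [LHS](score_momentE P p gamma hdelta_meas hdelta k (pZ i j)).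
  congr _%:E; rewrite -/(M i j k).
  (* Each index in turn is moved to the last slot by symmetry and replaced by [z] there. *)
  by rewrite (M3 i j k z) M13 M12 (M3 j z i z) M13 (M3 z z j z).
Qed.
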